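(* Let $3 \le d \le q$ and let $\mathcal{C} \subset \mathbb{P}^2$ be a projective plane curve of degree $d$ defined over $\mathbb{F}_q$. If $|\mathcal{C}(\mathbb{F}_q)| < dq + 1$, then $|\mathcal{C}(\mathbb{F}_q)| \le dq - d + 3$.
   Context: $\mathbb{F}_q$ is the finite field with $q$ elements. A projective plane curve of degree $d$ defined over $\mathbb{F}_q$ is the zero set in $\mathbb{P}^2$ of a nonzero homogeneous polynomial of degree $d$ in three variables over $\mathbb{F}_q$; $\mathcal{C}(\mathbb{F}_q)$ denotes its set of $\mathbb{F}_q$-rational points. *)

(* Defs.v *)
From HB Require Import structures.
From mathcomp Require Import all_boot all_order all_algebra all_field.
From mathcomp Require Import mpoly.
Set Implicit Arguments. Unset Strict Implicit. Unset Printing Implicit Defensive.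
Import GRing.Theory.
Local Open Scope ring_scope.

Definition vec3 (F : finFieldType) := {ffun 'I_3 -> F}.

(* The projective point (line through the origin, minus 0) determined by a
   nonzero vector v : the set of all nonzero scalar multiples of v. *)
Definition proj_class (F : finFieldType) (v : vec3 F) : {set vec3 F} :=
  [set [ffun i => k * v i] | k in [set k : F | k != 0]].

Definition rat_points (F : finFieldType) (P : {mpoly F[3]}) : {set {set vec3 F}} :=
  [set proj_class v | v in [set v : vec3 F | (v != 0) && (P.@[v] == 0)]].

(* Main.v *)
(** Suppose that [dq - d + 3 < N <= dq] for the number [N] of rational points of the
curve [f = 0], and call [d] minus the number of zeros of [f] on a line its deficiency.
The deficiencies of the [q + 1] lines through a point [p] with [f p != 0] add up to
[d(q + 1) - N <= 2d - 4].

In coordinates where the lines through [p] are the lines [x = a], [f] becomes a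
polynomial in [y] over [F[x]], monic up to a constant, and the deficiency of [x = a] is
the rank at [a] of multiplication by [y^q - y] modulo [f].  Bounding the degree of the
subresultants of [f] and [y^q - y] shows that if some line [x = a] has deficiency [s],
then the deficiencies of all these lines, truncated at [s], add up to at least
[s(d - s)].  Since the line at infinity of the pencil can be chosen freely, this forces
every line not contained in the curve to have deficiency [0] or [1].  If two lines are
contained in the curve, counting on the pencil through their common point gives the
bound directly; otherwise the first two moments of the number of zeros on a line are
incompatible, because a quadratic in [N] has negative discriminant. *)

Require Import Defs.
From HB Require Import structures.
From mathcomp Require Import all_boot all_order perm all_algebra all_field zify.
From mathcomp Require Import mxabelem.
From mathcomp Require Import mpoly.
Set Implicit Arguments. Unset Strict Implicit. Unset Printing Implicit Defensive.
Import GRing.Theory.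
Local Open Scope ring_scope.

(** * Determinants of polynomial matrices and orders of roots *)

(** Constant invertible row and column operations bring the value at [a] to [pid_mx r]. Then [s - r]
    rows vanish at [a], and each of them gives a factor [X - a] in every term of the Leibniz
    expansion. *)
Lemma dvdp_det_rank (F : fieldType) (s : nat) (M : 'M[{poly F}]_s) (a : F) :
  ('X - a%:P) ^+ (s - \rank (map_mx (horner_eval a) M)) %| \det M.
Proof.
set Ma := map_mx _ M; set r := \rank Ma.
pose L := map_mx polyC (invmx (col_ebase Ma)).
pose U := map_mx polyC (invmx (row_ebase Ma)).
pose M' := L *m M *m U.
have constE (A : 'M[F]_s) : map_mx (horner_eval a) (map_mx polyC A) = A.
  by apply/matrixP=> i j; rewrite !mxE /horner_eval hornerC.
have M'a : map_mx (horner_eval a) M' = pid_mx r.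
  rewrite !map_mxM !constE -/Ma -[X in _ *m X *m _]mulmx_ebase -/r !mulmxA.
  by rewrite mulVmx ?col_ebase_unit // mul1mx mulmxK ?row_ebase_unit.
have detM' : \det M' %= \det M.
  rewrite !det_mulmx !det_map_mx /= mulrC mulrA -polyCM mul_polyC.
  apply: eqp_scale; rewrite mulf_neq0 // -unitfE.
    by have := row_ebase_unit Ma; rewrite -unitmx_inv unitmxE.
  by have := col_ebase_unit Ma; rewrite -unitmx_inv unitmxE.
rewrite -(eqp_dvdr _ detM') /determinant.
apply: (big_ind (fun x => _ %| x)) => [||sg _]; first exact: dvdp0.
  by move=> x y; apply: dvdp_add.
apply: dvdp_mull.
(* The exponent is written as the number of vanishing rows, so that divisibility can be checked
   factor by factor. *)
have -> : (s - r)%N = (\sum_(i < s) (r <= i))%N.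
  by elim: (s) => [|n IH]; rewrite ?big_ord0 // big_ord_recr /= -IH; case: leqP; lia.
rewrite -prodrXr; apply: (big_ind2 (fun x y => x %| y)) => [|x1 x2 y1 y2|i _].
- exact: dvdpp.
- exact: dvdp_mul.
case: leqP => [le_ri|_]; last by rewrite expr0 dvd1p.
rewrite expr1 dvdp_XsubCl rootE.
have /matrixP/(_ i (sg i)) := M'a; rewrite !mxE /horner_eval => ->.
by rewrite ltnNge le_ri andbF.
Qed.

(** Powers of distinct [X - a] are coprime, so their product divides [g]. *)
Lemma sum_root_order_le (F : finFieldType) (g : {poly F}) (m : F -> nat) :
  g != 0 -> (forall a, ('X - a%:P) ^+ m a %| g) -> (\sum_a m a <= (size g).-1)%N.
Proof.
move=> g0 dvg.
have sz (A : seq F) : size (\prod_(a <- A) ('X - a%:P) ^+ m a) = (\sum_(a <- A) m a).+1.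
  elim: A => [|a A IH]; first by rewrite !big_nil size_poly1.
  rewrite !big_cons size_mul ?expf_neq0 ?polyXsubC_eq0 //; last first.
    by rewrite -size_poly_gt0 IH.
  by rewrite IH size_exp_XsubC addnS.
suff /dvdp_leq: \prod_(a <- index_enum F) ('X - a%:P) ^+ m a %| g.
  by move=> /(_ g0); rewrite sz; case: (size g).
elim: (index_enum F) (index_enum_uniq F) => [|a A IH] /=.
  by rewrite big_nil dvd1p.
case/andP=> aA uA; rewrite big_cons Gauss_dvdp ?dvg ?IH //.
apply: coprimep_expl; rewrite coprimep_sym coprimep_XsubC.
rewrite /root horner_prod prodf_seq_neq0; apply/allP => b bA /=.
rewrite horner_exp hornerXsubC expf_eq0 subr_eq0 negb_and.
by apply/orP; right; apply: contraNneq aA => ->.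
Qed.

(** * Remainders of bounded total degree and the subresultant bound *)

(** Total degree at most [n] in x and y, where y is the outer variable. For [i > n] the truncated
    subtraction is 0, which forces the coefficient to vanish. *)
Definition weight_le (F : nzRingType) (n : nat) (A : {poly {poly F}}) :=
  forall i, (size (A`_i)%R <= n.+1 - i)%N.

(** Division by a polynomial monic in y does not raise the total degree: each reduction step
    subtracts a multiple of [Phi] that respects the same bound. *)
Lemma weight_le_div (F : idomainType) d (Phi : {poly {poly F}}) n (A : {poly {poly F}}) :
  weight_le d Phi -> Phi`_d = 1 -> weight_le n A ->
  exists Q, weight_le n (A - Q * Phi) /\ (size (A - Q * Phi)%R <= d)%N.
Proof.
move=> wPhi Phid; move: {2}(size A) (leqnn (size A)) => m.
have sPhi : (size Phi <= d.+1)%N.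
  apply/leq_sizeP => j dj; apply/eqP; rewrite -size_poly_leq0.
  by apply: leq_trans (wPhi j) _; lia.
elim: m A => [|m IH] A sA wA.
  by exists 0; rewrite mul0r subr0; split=> //; apply: leq_trans sA _.
have [le_md|lt_dm] := leqP m.+1 d.
  by exists 0; rewrite mul0r subr0; split=> //; apply: leq_trans sA _.
pose B := A`_m *: 'X^(m - d) : {poly {poly F}}.
have coefBP i : (B * Phi)`_i = if (i < m - d)%N then 0 else A`_m * Phi`_(i - (m - d)).
  by rewrite /B -scalerAl coefZ coefXnM; case: ifP; rewrite ?mulr0.
have [|i|Q [wQ sQ]] := IH (A - B * Phi); last first.
- by exists (B + Q); rewrite mulrDl opprD addrA.
- rewrite coefB coefBP; case: ltnP => [|le_i]; first by rewrite subr0 wA.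
  apply: leq_trans (size_polyD _ _) _; rewrite geq_max wA size_polyN /=.
  have [->|Am0] := eqVneq A`_m 0; first by rewrite mul0r size_poly0.
  have [->|P0] := eqVneq Phi`_(i - (m - d)) 0; first by rewrite mulr0 size_poly0.
  rewrite size_mul //; move: (wA m) (wPhi (i - (m - d))%N) Am0 P0.
  rewrite -!size_poly_gt0; move: (size A`_m) (size Phi`_(i - (m - d))) => x y; lia.
apply/leq_sizeP => j; rewrite leq_eqVlt coefB coefBP => /orP[/eqP<-|lt_mj].
  by rewrite ltnNge leq_subr /= subKn ?Phid ?mulr1 ?subrr.
have -> : (j < m - d)%N = false by lia.
rewrite (leq_sizeP _ _ sA j) // sub0r.
by rewrite (leq_sizeP _ _ sPhi) ?mulr0 ?oppr0 //; lia.
Qed.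

(** The entry [(i, j)] has degree at most [(q - k) + j - i], and the shifts [j - i] cancel along a
    permutation. The hypothesis [k + s <= q] keeps the truncated subtractions exact. *)
Lemma leq_size_det (F : idomainType) s q k (M : 'M[{poly F}]_s) :
  (k + s <= q)%N -> (forall i j, size (M i j) <= (q + j).+1 - (k + i))%N ->
  (size (\det M) <= (s * (q - k)).+1)%N.
Proof.
move=> ksq sM; rewrite /determinant.
apply: (big_ind (fun x : {poly F} => size x <= _)%N) => [|x y sx sy|sg _].
- by rewrite size_poly0.
- by apply: leq_trans (size_polyD _ _) _; rewrite geq_max sx.
rewrite mulr_sign.
suff szp : (size (\prod_i M i (sg i))%R <= (s * (q - k)).+1)%N.
  by case: ifP; rewrite ?size_polyN.
apply: leq_trans (size_poly_prod_leq _ _) _.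
have Esum : (\sum_(i < s) ((q + sg i).+1 - (k + i)) = s * (q - k).+1)%N.
  apply/eqP; rewrite -(eqn_add2r (\sum_(i < s) (k + i))%N) -big_split /=.
  rewrite (eq_bigr (fun i => q.+1 + sg i)%N); last by move=> i _; have := ltn_ord i; lia.
  have -> : (\sum_(i < s) (q.+1 + sg i) = \sum_(i < s) (q.+1 + i))%N.
    by rewrite [RHS](reindex_inj (@perm_inj _ sg)).
  rewrite !big_split /=.
  by rewrite !sum_nat_const card_ord addnA eqn_add2r -mulnDr; apply/eqP; congr muln; lia.
have le_sum : (\sum_(i < s) size (M i (sg i)) <= s * (q - k).+1)%N.
  by rewrite -Esum; apply: leq_sum => i _; apply: sM.
rewrite -[X in (_ - X)%N]/#|'I_s| card_ord leq_subLR addnS ltnS -mulnS.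
exact: le_sum.
Qed.

(* M is the matrix of V |-> V (y^q - y) mod Phi, for deg V < s, read on the s top
   coefficients.  Its value at a has rank at most d - z a, so X - a divides det M at
   least s - (d - z a) times, and M is invertible at a0. *)
Lemma sum_deficiency_ge (F : finFieldType) (d k s : nat) (Phi : {poly {poly F}})
    (z := fun a => #|[set y | root (map_poly (horner_eval a) Phi) y]|) (a0 : F) :
  weight_le d Phi -> Phi`_d = 1 -> (d <= #|F|)%N -> (k + s)%N = d ->
  z a0 = k -> (s * k <= \sum_a minn (d - z a) s)%N.
Proof.
move=> wPhi Phid dq ksd za0; set q := #|F| in dq.
pose G : {poly {poly F}} := 'X^q - 'X.
have wG (j : nat) : weight_le (q + j) ('X^j * G).
  move=> i; rewrite /G mulrBr -exprD -exprSr coefB !coefXn.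
  have q0 : (0 < q)%N by apply/card_gt0P; exists 0.
  case: eqP => [->|_]; case: eqP => [E|_]; rewrite ?subrr ?subr0 ?sub0r ?size_polyN
    ?size_poly0 ?size_poly1 //; lia.
(* The remainders of [y^j (y^q - y)] modulo [Phi] have y-degree below [d] and total degree at most
   [q + j], which is the shape [leq_size_det] needs. *)
have /fin_all_exists[Q QP] (j : 'I_s) : exists Q,
    weight_le (q + j) ('X^j * G - Q * Phi) /\ (size ('X^j * G - Q * Phi)%R <= d)%N.
  exact: weight_le_div.
pose R (j : 'I_s) := 'X^j * G - Q j * Phi.
pose M := \matrix_(i < s, j < s) (R j)`_(k + i).
pose ev (a : F) := map_poly (horner_eval a).
have evG a : ev a G = 'X^q - 'X by rewrite /ev rmorphB /= map_polyXn map_polyX.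
have evR a j : ev a (R j) = 'X^j * ('X^q - 'X) - ev a (Q j) * ev a Phi.
  by rewrite /ev /R rmorphB !rmorphM /= map_polyXn -/(ev a G) evG.
have coefev a p i : (ev a p)`_i = (p`_i).[a] by rewrite /ev coef_map.
have sevR a j : (size (ev a (R j)) <= d)%N.
  apply/leq_sizeP => i di; rewrite coefev.
  by have /leq_sizeP/(_ i di) -> := (QP j).2; rewrite horner0.
have Ma a i j : map_mx (horner_eval a) M i j = (ev a (R j))`_(k + i).
  by rewrite !mxE coefev.
(* [H a] is the gcd of [Phi(a, y)] and [y^q - y], of degree [z a]; [H' a] is its cofactor in
   [y^q - y]. *)
pose H a := \prod_(y in [set y | root (ev a Phi) y]) ('X - y%:P).
pose H' a := \prod_(y in ~: [set y | root (ev a Phi) y]) ('X - y%:P).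
have HH' a : 'X^q - 'X = H a * H' a.
  rewrite finField_genPoly (bigID (mem [set y | root (ev a Phi) y])) /=.
  by congr (_ * _); apply: eq_bigl => y; rewrite !inE.
have sH a : size (H a) = (z a).+1.
  by rewrite /H -big_filter size_prod_XsubC -cardE /z; congr _.+1; apply: eq_card.
have H0 a : H a != 0 by rewrite -size_poly_gt0 sH.
have HPhi a : H a %| ev a Phi.
  rewrite /H -big_enum; apply: uniq_roots_dvdp.
    by apply/allP=> y; rewrite mem_enum inE.
  by rewrite uniq_rootsE enum_uniq.
have HR a j : H a %| ev a (R j).
  by rewrite evR dvdp_sub // ?dvdp_mull // (HH' a) dvdp_mulr.
have sPhi a : size (ev a Phi) = d.+1.
  apply/eqP; rewrite eqn_leq; apply/andP; split; last first.
    by rewrite ltnNge; apply/negP => /leq_sizeP/(_ d (leqnn _))/eqP;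
      rewrite coefev Phid hornerC oner_eq0.
  apply/leq_sizeP => i di; rewrite coefev.
  have := wPhi i; rewrite (_ : d.+1 - i = 0)%N; last by lia.
  by rewrite leqn0 size_poly_eq0 => /eqP->; rewrite horner0.
(* All remainders at [a] are multiples of [H a] of degree below [d], so they lie in a space of
   dimension [d - z a], through which the matrix factors. *)
have rkM a : (\rank (map_mx (horner_eval a) M) <= d - z a)%N.
  pose W j := ev a (R j) %/ H a.
  have sW j : (size (W j) <= d - z a)%N.
    by rewrite size_divp // sH /= leq_sub2r.
  pose A := \matrix_(i < s, l < d - z a) ('X^l * H a)`_(k + i).
  pose B := \matrix_(l < d - z a, j < s) (W j)`_l.
  have -> : map_mx (horner_eval a) M = A *m B.
    apply/matrixP => i j; rewrite Ma -(divpK (HR a j)) -/(W j) mxE.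
    have {1}-> : W j = \poly_(l < d - z a) (W j)`_l.
      apply/polyP => l; rewrite coef_poly; case: ltnP => // dl.
      by rewrite (leq_sizeP _ _ (sW j)).
    rewrite poly_def mulr_suml coef_sum; apply: eq_bigr => l _.
    by rewrite !mxE -scalerAl coefZ mulrC.
  exact: leq_trans (mxrankM_maxl _ _) (rank_leq_col _).
(* A kernel vector at [a0] is a nonzero [V] of degree below [s] for which [V (y^q - y)] is congruent
   modulo [Phi(a0, y)] to some [S] of degree below [k]. Since [H a0], of degree [k], divides [S],
   [S = 0]. Then the cofactor [f'] of [H a0] in [Phi(a0, y)], of degree [s], divides [V], which is
   absurd. *)
have detM0 : \det M != 0.
  apply/negP => /eqP detM.
  have /det0P[v v0 vM] : \det (map_mx (horner_eval a0) M)^T == 0.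
    by rewrite det_tr det_map_mx detM /= /horner_eval horner0.
  pose V := rVpoly v.
  pose S := \sum_j v 0 j *: ev a0 (R j).
  have SE : S = V * ('X^q - 'X) - (\sum_j v 0 j *: ev a0 (Q j)) * ev a0 Phi.
    rewrite /V /rVpoly poly_def !mulr_suml -sumrB; apply: eq_bigr => j _.
    by rewrite insubT ?ltn_ord // => lt_j; rewrite evR scalerBr !scalerAl;
      congr (_ *: _ * _ - _); congr (v _ _); apply: val_inj.
  have sS : (size S <= k)%N.
    apply/leq_sizeP => i ki; have [id|di] := ltnP i d; last first.
      rewrite coef_sum big1 // => j _.
      by rewrite coefZ (leq_sizeP _ _ (sevR a0 j)) ?mulr0.
    have lt_is : (i - k < s)%N by lia.
    have /rowP/(_ (Ordinal lt_is)) := vM; rewrite !mxE => vMi.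
    rewrite coef_sum -[RHS]vMi; apply: eq_bigr => j _.
    by rewrite coefZ mxE Ma /= subnKC.
  have S0 : S = 0.
    apply/eqP; apply: contraLR sS => S0; rewrite -ltnNge.
    have := dvdp_leq S0 (_ : H a0 %| S); rewrite sH za0; apply.
    apply: (big_ind (fun x => _ %| x)) => [|x y|j _]; first exact: dvdp0.
      exact: dvdp_add.
    by rewrite -mul_polyC dvdp_mull.
  pose f' := ev a0 Phi %/ H a0.
  have f'E : ev a0 Phi = f' * H a0 by rewrite divpK.
  have f'V : f' %| V.
    (* The roots of [H' a0] are the [y] with [Phi(a0, y)] nonzero, so none of them is a root of
       [f']. *)
    have cop : coprimep f' (H' a0).
      apply: (big_ind (coprimep f')) => [|x y cx cy|y]; first exact: coprimep1.
        by rewrite coprimepMr cx.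
      rewrite !inE coprimep_XsubC; apply: contra => f'y.
      by rewrite f'E rootM f'y.
    rewrite -(Gauss_dvdpl _ cop) -(dvdp_mul2r _ _ (H0 a0)) -f'E.
    move/eqP: SE; rewrite S0 eq_sym subr_eq0 (HH' a0) mulrCA mulrA => /eqP E.
    by rewrite -mulrA [_ * H a0]mulrC mulrA [V * _]mulrC E dvdp_mull.
  have sf' : size f' = s.+1 by rewrite size_divp // sPhi sH za0 /= ; lia.
  have V0 : V = 0.
    apply/eqP; apply: contraTT isT => V0.
    have := dvdp_leq V0 f'V; rewrite sf' => sV.
    by have := leq_trans sV (size_poly _ _); rewrite ltnn.
  by case/eqP: v0; apply: (can_inj rVpolyK); rewrite -/V V0 linear0.
have dvd_det a : ('X - a%:P) ^+ (s - (d - z a)) %| \det M.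
  by apply: dvdp_trans (dvdp_det_rank M a); rewrite dvdp_exp2l // leq_sub2l.
have le1 := sum_root_order_le detM0 dvd_det.
have le2 : (size (\det M) <= (s * (q - k)).+1)%N.
  apply: leq_size_det; first by lia.
  by move=> i j; rewrite mxE; apply: (QP j).1.
(* As [min(e, s) + (s - e) = s], the upper bound [s (q - k)] on the degree of the determinant
   becomes a lower bound on the truncated deficiencies. *)
have E : (\sum_a minn (d - z a) s + \sum_a (s - (d - z a)) = q * s)%N.
  rewrite -big_split /= (eq_bigr (fun => s)) ?sum_nat_const // => a _.
  by rewrite /minn; case: ltnP; lia.
have kq : (k <= q)%N by lia.
have Eq : (s * (q - k) + s * k = q * s)%N by rewrite -mulnDr subnK // mulnC.
move: le1 le2 E; rewrite -Eq; move: (size _) (\sum_a minn _ _)%N (\sum_a (s - _))%N.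
move: (s * (q - k))%N (s * k)%N => x y n1 n2 n3; lia.
Qed.

(** * The polynomial of a form on a pencil of lines *)

(* If A is f(x, y, 1) for a form f of degree n, then top_part n A is f(1, y, 0). *)
Definition top_part (F : nzRingType) n (A : {poly {poly F}}) : {poly F} :=
  \poly_(i < n.+1) A`_i`_(n - i).

(** Bundling the degree bound, the part at infinity and the coefficient of [y^n] lets one induction
    over the monomials of a form and their linear factors compute all three. *)
Definition graded (F : nzRingType) n (A : {poly {poly F}}) (T : {poly F}) (c : F) :=
  [/\ weight_le n A, top_part n A = T & A`_n = c%:P].

Lemma graded0 (F : nzRingType) n : graded n (0 : {poly {poly F}}) 0 0.
Proof.
split; [by move=> i; rewrite coef0 size_poly0 | | by rewrite coef0].
by apply/polyP => i; rewrite coef_poly !coef0 if_same.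
Qed.

Lemma gradedD (F : nzRingType) n (A B : {poly {poly F}}) S T c e :
  graded n A S c -> graded n B T e -> graded n (A + B) (S + T) (c + e).
Proof.
move=> [wA <- cA] [wB <- cB]; split; last by rewrite coefD cA cB polyCD.
  by move=> i; rewrite coefD; apply: leq_trans (size_polyD _ _) _; rewrite geq_max wA wB.
apply/polyP => i; rewrite coefD !coef_poly !coefD.
by case: ifP; rewrite ?addr0.
Qed.

Lemma gradedZ (F : idomainType) n (A : {poly {poly F}}) T c (b : F) :
  graded n A T c -> graded n (b%:P *: A) (b *: T) (b * c).
Proof.
move=> [wA <- cA]; split; last by rewrite coefZ cA polyCM.
  move=> i; rewrite coefZ mul_polyC; apply: leq_trans (size_scale_leq _ _) (wA i).
apply/polyP => i; rewrite coefZ !coef_poly coefZ.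
by case: ifP; rewrite ?mulr0 ?coefCM.
Qed.

Section LinearForm.
Variables (F : idomainType) (x y w : F).

(** One coordinate of the generic point [X u + Y p + w], with inner variable X and outer variable Y;
    [x], [y], [w] are the entries of [u], [p], [w]. *)
Definition lin2 : {poly {poly F}} := y%:P *: 'X + (x *: 'X + w%:P)%:P.

(** The constant [w] of the linear form affects only lower total degree, so it disappears from the
    top part and from the coefficient of [y^(n+1)]. *)
Lemma gradedML n A T c :
  graded n A T c -> graded n.+1 (lin2 * A) ((x%:P + y *: 'X) * T) (y * c).
Proof.
move=> [wA <- cA].
have A0 i : (n < i)%N -> A`_i = 0.
  move=> ni; apply/eqP; rewrite -size_poly_leq0; apply: leq_trans (wA i) _; lia.
have coefL i : (lin2 * A)`_i =
    y *: (if i == 0%N then 0 else A`_i.-1) + (x *: ('X * A`_i) + w *: A`_i).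
  rewrite /lin2 mulrDl coefD -scalerAl coefZ coefXM mul_polyC; congr (_ + _).
  by rewrite coefCM mulrDl mul_polyC -scalerAl.
split; last first.
- by rewrite coefL /= (A0 n.+1) // mulr0 !scaler0 !addr0 cA -mul_polyC polyCM.
- apply/polyP => i; rewrite [in RHS]mulrDl [RHS]coefD mul_polyC coefZ -scalerAl coefZ coefXM !coef_poly.
  rewrite !ltnS; case: ifP => [le_i|gt_i]; last first.
    have -> : (i <= n)%N = false by lia.
    by case: i gt_i => [|i] //= gt_i; rewrite ltnS in gt_i *; rewrite gt_i !mulr0 addr0.
  rewrite coefL coefD [in LHS]coefD !coefZ coefXM addrC; congr (_ + _).
    have [le_in|lt_ni] := leqP i n; last first.
      by rewrite A0 // !coef0 if_same !mulr0 addr0.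
    rewrite subSn //= [X in _ + w * X](leq_sizeP _ _ (wA i)) ?mulr0 ?addr0 //.
    by rewrite subSn.
  congr (_ * _); case: i le_i => [|i] //=; first by rewrite coef0.
  by rewrite !ltnS => ->; rewrite subSS.
move=> i; rewrite coefL; apply: leq_trans (size_polyD _ _) _; rewrite geq_max.
apply/andP; split.
  apply: leq_trans (size_scale_leq _ _) _; case: i => [|i] /=; first by rewrite size_poly0.
  exact: wA.
apply: leq_trans (size_polyD _ _) _; rewrite geq_max; apply/andP; split.
  apply: leq_trans (size_scale_leq _ _) _.
  have [->|Ai0] := eqVneq A`_i 0; first by rewrite mulr0 size_poly0.
  rewrite mulrC size_mulX //; have := wA i.
  by move: Ai0; rewrite -size_poly_gt0; move: (size A`_i) => m; lia.
apply: leq_trans (size_scale_leq _ _) _; have := wA i; lia.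
Qed.

Lemma gradedMLX e n A T c : graded n A T c ->
  graded (e + n) (lin2 ^+ e * A) ((x%:P + y *: 'X) ^+ e * T) (y ^+ e * c).
Proof.
move=> gA; elim: e => [|e IH]; first by rewrite !expr0 !mul1r.
by rewrite !exprS -!mulrA addSn; apply: gradedML.
Qed.

End LinearForm.

Lemma graded_monomial (F : idomainType) k (x y w : 'I_k -> F) (m : 'I_k -> nat) :
  graded (\sum_i m i) (\prod_i lin2 (x i) (y i) (w i) ^+ m i)
    (\prod_i ((x i)%:P + y i *: 'X) ^+ m i) (\prod_i y i ^+ m i).
Proof.
elim: (index_enum _) => [|i r IH]; rewrite ?big_nil ?big_cons; last exact: gradedMLX.
split; last by rewrite coef1.
  by move=> [|i]; rewrite coef1 ?size_poly1 ?size_poly0.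
by apply/polyP => [[|i]]; rewrite coef_poly !coef1.
Qed.

Definition eval_row (F : comNzRingType) k (P : {mpoly F[k]}) (v : 'rV[F]_k) := P.@[v 0].

(** The generic point of the pencil at [p] is substituted into [P]. The value [a] of X selects the
    line through [p] and [a u + w]; the line through [p] and [u] is at infinity and is read off from
    [top_part]. *)
Lemma chart_poly (F : idomainType) k d (P : {mpoly F[k]}) (u p w : 'rV[F]_k) :
  P \is d.-homog -> exists Phi : {poly {poly F}},
  [/\ weight_le d Phi,
      forall a y, (map_poly (horner_eval a) Phi).[y] = eval_row P (a *: u + y *: p + w),
      forall y, (top_part d Phi).[y] = eval_row P (u + y *: p)
    & Phi`_d = (eval_row P p)%:P].
Proof.
move=> /dhomogP Phom.
pose L i := lin2 (u 0 i) (p 0 i) (w 0 i).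
pose Phi := \sum_(m <- msupp P) (P@_m)%:P *: \prod_i L i ^+ m i.
pose T := \sum_(m <- msupp P) P@_m *: \prod_i ((u 0 i)%:P + p 0 i *: 'X) ^+ m i.
have : graded d Phi T (eval_row P p).
  rewrite /Phi /T /eval_row mevalE; move: Phom.
  elim: (msupp P : seq _) => [|m r IH] Phom; first by rewrite !big_nil; apply: graded0.
  rewrite !big_cons; apply: gradedD; last first.
    by apply: IH => m' m'r; apply: Phom; rewrite inE m'r orbT.
  apply: gradedZ; rewrite -(Phom m) ?mem_head //= mdegE.
  exact: graded_monomial.
case=> wPhi topPhi cPhi; exists Phi; split=> // [a y|y].
  rewrite /Phi rmorph_sum horner_sum /eval_row mevalE; apply: eq_bigr => m _.
  rewrite /= map_polyZ hornerZ /= /horner_eval hornerC; congr (_ * _).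
  rewrite -/(horner_eval a) rmorph_prod horner_prod; apply: eq_bigr => i _.
  rewrite rmorphXn horner_exp /=; congr (_ ^+ _).
  rewrite /L /lin2 rmorphD /= map_polyZ map_polyX map_polyC !mxE /horner_eval.
  by rewrite !hornerE /= /horner_eval !hornerE /= [X in X + _]addrC [_ * a]mulrC [_ * y]mulrC.
rewrite topPhi /T horner_sum /eval_row mevalE; apply: eq_bigr => m _.
rewrite hornerZ horner_prod; congr (_ * _); apply: eq_bigr => i _.
by rewrite horner_exp !hornerE !mxE mulrC.
Qed.

(** * Linearly independent pairs and triples over a finite field *)

Definition free2 (F : fieldType) n (p w : 'rV[F]_n) :=
  forall y z, y *: p + z *: w = 0 -> y = 0 /\ z = 0.

Definition free3 (F : fieldType) n (u p w : 'rV[F]_n) :=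
  forall x y z, x *: u + y *: p + z *: w = 0 -> [/\ x = 0, y = 0 & z = 0].

(** Only [q] vectors are multiples of [p], so a larger set contains one that is not. *)
Lemma free2_extend (F : finFieldType) n (p : 'rV[F]_n) (S : {set 'rV[F]_n}) :
  p != 0 -> (#|F| < #|S|)%N -> exists2 w, w \in S & free2 p w.
Proof.
move=> p0 ltS; have : ~~ (S \subset [set y *: p | y : F]).
  apply: contraL ltS => /subset_leq_card leS; rewrite -leqNgt.
  exact: leq_trans leS (leq_trans (leq_imset_card _ _) (max_card _)).
case/subsetPn=> w wS wNp; exists w => // y z E.
have z0 : z = 0.
  apply/eqP; apply: contraNT wNp => z0; apply/imsetP; exists (- (z^-1 * y)) => //.
  have : z^-1 *: (y *: p + z *: w) = 0 by rewrite E scaler0.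
  by rewrite scalerDr !scalerA mulVf // scale1r addrC scaleNr => /eqP; rewrite addr_eq0 => /eqP.
split=> //; move/eqP: E; rewrite z0 scale0r addr0 scaler_eq0 (negPf p0) orbF.
by move/eqP.
Qed.

Lemma free3_extend (F : finFieldType) n (p w u : 'rV[F]_n) :
  free2 p w -> (forall y z, u != y *: p + z *: w) -> free3 u p w.
Proof.
move=> pw uN x y z E.
have x0 : x = 0.
  apply/eqP; apply/negPn; apply/negP => x0.
  have : x^-1 *: (x *: u + y *: p + z *: w) = 0 by rewrite E scaler0.
  rewrite -addrA scalerDr scalerA mulVf // scale1r => /eqP; rewrite addr_eq0.
  rewrite scalerDr !scalerA opprD -!scaleNr => /eqP Eu.
  by have /eqP := uN (- (x^-1 * y)) (- (x^-1 * z)).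
by move: E; rewrite x0 scale0r add0r => /pw[-> ->].
Qed.

Lemma free2_span_card (F : finFieldType) n (p w : 'rV[F]_n) :
  free2 p w -> #|[set x.1 *: p + x.2 *: w | x : F * F]| = (#|F| ^ 2)%N.
Proof.
move=> pw; rewrite card_imset ?card_prod ?mulnn // => -[y z] [y' z'] /= /eqP.
rewrite -subr_eq0 opprD addrACA -!scalerBl => /eqP/pw[/eqP + /eqP].
by rewrite !subr_eq0 => /eqP-> /eqP->.
Qed.

Lemma free3_bij (F : finFieldType) (u p w : 'rV[F]_3) : free3 u p w ->
  bijective (fun t : F * F * F => t.1.1 *: u + t.1.2 *: p + t.2 *: w).
Proof.
move=> upw; apply: inj_card_bij.
  move=> [[x y] z] [[x' y'] z'] /= /eqP.
  rewrite -subr_eq0 !opprD addrACA [X in X + _]addrACA -!scalerBl => /eqP/upw[].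
  by move=> /eqP + /eqP + /eqP; rewrite !subr_eq0 => /eqP-> /eqP-> /eqP->.
by rewrite card_mx !card_prod !expnS expn0 muln1 mulnA.
Qed.

(** * Counting zeros along the lines through a point *)

Section Counting.
Variables (F : finFieldType) (d : nat) (P : {mpoly F[3]}).
Hypothesis Phom : P \is d.-homog.
Local Notation f := (eval_row P).
Local Notation q := #|F|.

(* The zeros of f on the line through p and v, other than p. *)
Definition aff_zeros (p v : 'rV[F]_3) := #|[set y | f (v + y *: p) == 0]|.
(** The affine cone over the curve without its origin. Every projective point contributes [q - 1]
    vectors, whence the factors [q - 1] in the counts. *)
Definition cone_zeros := [set v : 'rV[F]_3 | (v != 0) && (f v == 0)].

Lemma eval_rowZ k v : f (k *: v) = k ^+ d * f v.
Proof.
rewrite /eval_row !mevalE mulr_sumr; apply: eq_big_seq => m mP.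
rewrite mulrCA; congr (_ * _); move/dhomogP: Phom => /(_ m mP) <-.
rewrite /= mdegE -prodrXr -big_split /=; apply: eq_bigr => i _.
by rewrite mxE exprMn.
Qed.

Lemma cone_zerosZ k v : k != 0 -> (k *: v \in cone_zeros) = (v \in cone_zeros).
Proof.
by move=> k0; rewrite !inE eval_rowZ scaler_eq0 mulf_eq0 expf_eq0 (negPf k0) andbF.
Qed.

Lemma plane_sum p w : free2 p w ->
  (\sum_z \sum_y ((z *: w + y *: p)%R \in cone_zeros) =
   (q - 1) * ((f p == 0)%R + aff_zeros p w))%N.
Proof.
move=> pw; have card0 : #|[pred z : F | z != 0]| = (q - 1)%N.
  by rewrite subn1 -(cardC1 (0 : F)); apply: eq_card.
rewrite (bigD1 0) //= mulnDr; congr addn.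
  rewrite (bigD1 0) //= !scale0r !add0r [X in (X + _)%N](_ : _ = 0)%N ?inE ?eqxx ?add0n //.
  rewrite (eq_bigr (fun => (f p == 0)%R : nat)); last first.
    move=> y y0; rewrite ?scale0r ?add0r cone_zerosZ // inE.
    case: eqP => [p0|//]; have := pw 1 0.
    by rewrite p0 scaler0 scale0r addr0 => /(_ erefl)[/eqP]; rewrite oner_eq0.
  by rewrite sum_nat_const card0.
rewrite (eq_bigr (fun => aff_zeros p w)) ?sum_nat_const ?card0 // => z z0.
(* Replacing [y] by [z y] makes the vector a multiple of [w + y p], so each nonzero [z] contributes
   the same count. *)
rewrite (reindex_inj (mulfI z0)) /= /aff_zeros -sum1_card [RHS]big_mkcond /=.
apply: eq_bigr => y _; rewrite -scalerA -scalerDr cone_zerosZ // !inE.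
have -> : w + y *: p != 0; last by case: ifP.
apply/eqP => E; have := pw y 1; rewrite scale1r addrC E => /(_ erefl)[_ /eqP].
by rewrite oner_eq0.
Qed.

(** In the basis [u, p, w], the vectors with [z = 0] form the plane over the line through [p] and
    [u]; those with [z != 0] scale to [z = 1], where the coefficient of [u] names one of the other
    [q] lines through [p]. *)
Lemma pencil_sum u p w : free3 u p w ->
  #|cone_zeros| =
    ((q - 1) * ((f p == 0)%R + aff_zeros p u + \sum_a aff_zeros p (a *: u + w)%R))%N.
Proof.
move=> upw; have card0 : #|[pred z : F | z != 0]| = (q - 1)%N.
  by rewrite subn1 -(cardC1 (0 : F)); apply: eq_card.
have pu : free2 p u.
  by move=> y x E; case: (upw x y 0) => //; rewrite scale0r addr0 addrC.
rewrite -sum1_card big_mkcond /= (reindex _ (onW_bij _ (free3_bij upw))) /=.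
rewrite -(pair_bigA _ (fun t z => if t.1 *: u + t.2 *: p + z *: w \in cone_zeros then 1%N else 0%N)) /=.
rewrite exchange_big /= (bigD1 0) //= mulnDr; congr addn.
  rewrite -plane_sum // pair_bigA; apply: eq_bigr => -[x y] _ /=.
  by rewrite scale0r addr0; case: (_ \in _).
rewrite (eq_bigr (fun=> \sum_a aff_zeros p (a *: u + w)%R))%N ?sum_nat_const ?card0 // => z z0.
rewrite -(pair_bigA _ (fun x y => if x *: u + y *: p + z *: w \in cone_zeros then 1%N else 0%N)) /=.
rewrite (reindex_inj (mulfI z0)) /=; apply: eq_bigr => a _.
rewrite (reindex_inj (mulfI z0)) /= /aff_zeros -sum1_card [RHS]big_mkcond /=.
apply: eq_bigr => y _; rewrite -!scalerA -!scalerDr cone_zerosZ // !inE addrAC.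
have -> // : a *: u + w + y *: p != 0.
apply/eqP => E; have := upw a y 1; rewrite scale1r addrAC E => /(_ erefl)[_ _ /eqP].
by rewrite oner_eq0.
Qed.

Lemma aff_zeros_chart u p w : exists Phi : {poly {poly F}},
  [/\ weight_le d Phi,
      forall a, aff_zeros p (a *: u + w) =
        #|[set y | root (map_poly (horner_eval a) Phi) y]|,
      aff_zeros p u = #|[set y | root (top_part d Phi) y]|
    & Phi`_d = (f p)%:P].
Proof.
have [Phi [wPhi eP tP cP]] := chart_poly u p w Phom.
exists Phi; split=> // [a|]; apply: eq_card => y; rewrite !inE /root ?eP ?tP //.
by rewrite addrAC.
Qed.

End Counting.

Lemma card_roots_lt (F : finFieldType) (g : {poly F}) :
  g != 0 -> (#|[set y | root g y]| < size g)%N.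
Proof.
move=> g0; rewrite cardE; apply: max_poly_roots => //; last exact: enum_uniq.
by apply/allP => y; rewrite mem_enum inE.
Qed.

Lemma mul_pred_pred m n : (0 < m -> 0 < n -> m.-1 * (n - 1) + m + n = n * m + 1)%N.
Proof. case: m n => // m [|n] // _ _; rewrite subn1 /=; lia. Qed.

(** * Bounds obtained from a single pencil *)

Section Pencils.
Variables (F : finFieldType) (d : nat) (P : {mpoly F[3]}).
Hypothesis Phom : P \is d.-homog.
Local Notation f := (eval_row P).
Local Notation q := #|F|.
Local Notation aff_zeros := (aff_zeros P).

Lemma aff_zeros_le p w : f p != 0 -> (aff_zeros p w <= d)%N.
Proof.
move=> fp; have [Phi [wPhi eP _ cP]] := aff_zeros_chart Phom 0 p w.
have := eP 0; rewrite scaler0 add0r => ->; set g := map_poly _ _.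
have gd : g`_d != 0 by rewrite coef_map cP /= /horner_eval hornerC.
have g0 : g != 0 by apply: contraNneq gd => ->; rewrite coef0.
have sg : (size g <= d.+1)%N.
  apply/leq_sizeP => i di; rewrite coef_map /=.
  have := wPhi i; rewrite (_ : d.+1 - i = 0)%N; last by lia.
  by rewrite leqn0 size_poly_eq0 => /eqP->; rewrite /horner_eval horner0.
by have := leq_trans (card_roots_lt g0) sg; rewrite ltnS.
Qed.

(** Dividing by [f p] makes the polynomial of the pencil monic in y. The sum omits the line through
    [p] and [u], so the choice of [u] decides which line is left out. *)
Lemma pencil_deficiency_ge u p w a0 (s := (d - aff_zeros p (a0 *: u + w))%N) :
  f p != 0 -> (d <= q)%N ->
  (s * (d - s) <= \sum_a minn (d - aff_zeros p (a *: u + w)%R) s)%N.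
Proof.
move=> fp dq; have [Phi [wPhi eP _ cP]] := aff_zeros_chart Phom u p w.
pose Psi := ((f p)^-1)%:P *: Phi.
have wPsi : weight_le d Psi.
  move=> i; rewrite coefZ mul_polyC; exact: leq_trans (size_scale_leq _ _) (wPhi i).
have cPsi : Psi`_d = 1 by rewrite coefZ cP -polyCM mulVf.
have ePsi a : aff_zeros p (a *: u + w) =
    #|[set y | root (map_poly (horner_eval a) Psi) y]|.
  rewrite eP; apply: eq_card => y; rewrite !inE /Psi map_polyZ /root hornerZ.
  by rewrite /= /horner_eval hornerC mulf_eq0 invr_eq0 (negPf fp).
have le_d := aff_zeros_le (a0 *: u + w) fp.
rewrite (eq_bigr _ (fun a _ => congr1 (fun z => minn (d - z) s) (ePsi a))).
apply: (sum_deficiency_ge wPsi cPsi dq _ (a0 := a0)); first by rewrite subnK // leq_subr.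
by rewrite -ePsi /s subKn.
Qed.

Lemma size_map_horner_le (Phi : {poly {poly F}}) a n :
  (forall i, (n <= i)%N -> (Phi`_i).[a] = 0) -> (size (map_poly (horner_eval a) Phi) <= n)%N.
Proof. by move=> Phi0; apply/leq_sizeP => i ni; rewrite coef_map; apply: Phi0. Qed.

Lemma weight_le_coef0 (Phi : {poly {poly F}}) i : weight_le d Phi -> (d < i)%N -> Phi`_i = 0.
Proof.
by move=> wPhi di; apply/eqP; rewrite -size_poly_leq0; apply: leq_trans (wPhi i) _; lia.
Qed.

Lemma card_roots_ltn (g : {poly F}) n :
  (#|[set y | root g y]| < q)%N -> (size g <= n)%N -> (#|[set y | root g y]| < n)%N.
Proof.
move=> ltq; apply: leq_trans; apply: card_roots_lt; apply: contraTneq ltq => ->.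
by rewrite -leqNgt -cardsT subset_leq_card //; apply/subsetP => y; rewrite !inE root0.
Qed.

(* Through a zero p of f the coefficient Phi_d vanishes and Phi_(d-1) is linear in
   the line; its zero is the tangent line, which carries at most d - 2 further zeros. *)
Lemma pencil_tangent_bound u p w N : free3 u p w -> (2 <= d)%N ->
  f p = 0 -> #|cone_zeros P| = ((q - 1) * N)%N ->
  (aff_zeros p u < q)%N -> (forall a, aff_zeros p (a *: u + w) < q)%N ->
  (N + q + 1 <= d * q + d)%N.
Proof.
move=> upw d2 fp; have q1 : (1 < q)%N by apply: card_finNzRing_gt1.
rewrite (pencil_sum Phom upw) fp eqxx => /eqP; rewrite eqn_pmul2l; last by lia.
move=> /eqP <-.
have [Phi [wPhi eP tP cP]] := aff_zeros_chart Phom u p w.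
have Phi0 i : (d <= i)%N -> Phi`_i = 0.
  rewrite leq_eqVlt => /orP[/eqP<-|]; first by rewrite cP fp.
  exact: weight_le_coef0.
move=> ltu lta.
have le_a a : (aff_zeros p (a *: u + w) <= d - 1)%N.
  have := lta a; rewrite eP => /card_roots_ltn/(_ (_ : _ <= d)%N) lt_d.
  have := lt_d _; rewrite leq_subRL; last by lia.
  rewrite add1n; apply.
  by apply: size_map_horner_le => i di; rewrite Phi0 ?horner0.
have top0 i : (d <= i)%N -> (top_part d Phi)`_i = 0.
  by move=> di; rewrite coef_poly Phi0 // coef0 if_same.
have le_u : (aff_zeros p u <= d - 1)%N.
  move: ltu; rewrite tP => /card_roots_ltn/(_ (_ : _ <= d)%N) lt_d.
  have := lt_d _; rewrite leq_subRL; last by lia.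
  rewrite add1n; apply.
  by apply/leq_sizeP => i; apply: top0.
have le_sum (B : pred F) : (\sum_(a | B a) aff_zeros p (a *: u + w) <= #|B| * (d - 1))%N.
  by rewrite -sum_nat_const; apply: leq_sum.
(* [(Phi_(d-1))_1] is also the coefficient of [y^(d-1)] in [top_part]. If it vanishes, the line at
   infinity serves as the tangent; otherwise the tangent is the line of the root [a0] of
   [Phi_(d-1)]. *)
have [al0|al0] := eqVneq (Phi`_d.-1)`_1 0.
  have : (aff_zeros p u < d - 1)%N.
    rewrite tP in ltu *; apply: card_roots_ltn => //; apply/leq_sizeP => i.
    rewrite leq_eqVlt => /orP[/eqP<-|di]; last by apply: top0; lia.
    rewrite coef_poly ifT; last by lia.
    by rewrite subn1 (_ : d - d.-1 = 1)%N //; lia.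
  have := le_sum predT; rewrite (_ : #|_| = q) //; move: (\sum_a _)%N (aff_zeros p u) => x y.
  have -> : (q * (d - 1) = d * q - q)%N by rewrite mulnBr muln1 mulnC.
  have : (q <= d * q)%N by rewrite leq_pmull //; lia.
  move: (d * q)%N => dq; lia.
pose a0 := - (Phi`_d.-1)`_0 / (Phi`_d.-1)`_1.
have ra0 : (Phi`_d.-1).[a0] = 0.
  rewrite (horner_coef_wide _ (wPhi _)) (_ : d.+1 - d.-1 = 2)%N; last by lia.
  by rewrite !big_ord_recl big_ord0 /= expr0 expr1 mulr1 addr0 /a0 mulrC divfK // subrr.
have : (aff_zeros p (a0 *: u + w) < d - 1)%N.
  have := lta a0; rewrite eP => lt; apply: card_roots_ltn => //.
  apply: size_map_horner_le => i.
  rewrite leq_eqVlt => /orP[/eqP<-|di]; first by rewrite subn1.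
  by rewrite Phi0 ?horner0 //; lia.
rewrite (bigD1 a0) //=.
have : (\sum_(a | a != a0) aff_zeros p (a *: u + w)%R <= q.-1 * (d - 1))%N.
  by rewrite -(cardC1 a0); apply: le_sum (predC1 a0).
move: (\sum_(a | _) _)%N (aff_zeros p u) le_u (aff_zeros p _) => x y le_y z.
have := mul_pred_pred (ltnW q1) (ltnW d2).
move: (q.-1 * (d - 1))%N (d * q)%N => m1 m2.
move: #|_| => n; lia.
Qed.

(** Let [n] of the lines besides the one at infinity lie in the curve. As the line at infinity does
    too, [Phi_i] has degree below [d - i]; having [n] roots, it vanishes for [i >= d - n]. Every
    other line thus has at most [d - n - 1] zeros besides [p]. If [n <= d - 2], this gives
    [N <= d q + 1 - n (d - 1 - n)]; if [n >= d - 1], the contained lines alone give [d q + 1]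
    points. *)
Lemma pencil_two_lines u p w N : free3 u p w -> (d <= q)%N ->
  f p = 0 -> #|cone_zeros P| = ((q - 1) * N)%N ->
  aff_zeros p u = q -> aff_zeros p w = q -> (N <= d * q - d + 3)%N \/ (d * q + 1 <= N)%N.
Proof.
move=> upw dq fp; have q1 : (1 < q)%N by apply: card_finNzRing_gt1.
rewrite (pencil_sum Phom upw) fp eqxx => /eqP; rewrite eqn_pmul2l; last by lia.
move=> /eqP <- uq wq; rewrite uq.
have [Phi [wPhi eP tP cP]] := aff_zeros_chart Phom u p w.
have Phi0 i : (d <= i)%N -> Phi`_i = 0.
  rewrite leq_eqVlt => /orP[/eqP<-|]; first by rewrite cP fp.
  exact: weight_le_coef0.
have eq0 (g : {poly F}) : (size g <= d)%N -> #|[set y | root g y]| = q -> g = 0.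
  move=> sg gq; apply/eqP; apply: contraTT isT => g0.
  by have := leq_trans (card_roots_lt g0) (leq_trans sg dq); rewrite gq ltnn.
have top0 : top_part d Phi = 0.
  apply: eq0; last by rewrite -tP.
  by apply/leq_sizeP => i di; rewrite coef_poly Phi0 // coef0 if_same.
have sPhi i : (size (Phi`_i)%R <= d - i)%N.
  have [id|di] := ltnP i d; last by rewrite Phi0 ?size_poly0.
  apply/leq_sizeP => j; rewrite leq_eqVlt => /orP[/eqP<-|dj]; last first.
    by rewrite (leq_sizeP _ _ (wPhi i)) //; lia.
  have /polyP/(_ i) := top0; rewrite coef_poly coef0 ifT //; lia.
pose A := [set a | aff_zeros p (a *: u + w) == q].
have A1 : (0 < #|A|)%N.
  by apply/card_gt0P; exists 0; rewrite inE scale0r add0r wq.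
have PhiA i : (d - #|A| <= i)%N -> Phi`_i = 0.
  move=> iA; apply/eqP; apply: contraTT isT => Phi_i0.
  suff : (#|A| < size (Phi`_i)%R)%N by have := sPhi i; lia.
  rewrite cardE; apply: max_poly_roots => //; last exact: enum_uniq.
  apply/allP => a; rewrite mem_enum inE eP => /eqP/eq0.
  rewrite size_map_horner_le => [/(_ isT)/polyP/(_ i)|j dj]; last by rewrite Phi0 ?horner0.
  by rewrite coef_map coef0 /root => /eqP.
have cA a : a \notin A -> (aff_zeros p (a *: u + w) < d - #|A|)%N.
  rewrite inE => neq_q; rewrite eP in neq_q *; apply: card_roots_ltn.
    by rewrite ltn_neqAle neq_q max_card.
  by apply: size_map_horner_le => i /PhiA ->; rewrite horner0.
have cAq : (#|A| + #|~: A| = q)%N by rewrite cardsC.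
rewrite (bigID (mem A)) /= (eq_bigr (fun=> q)); last by move=> a; rewrite inE => /eqP.
rewrite sum_nat_const.
have [leA|gtA] := leqP d.-1 #|A|.
  right; have : (d.-1 * q <= #|A| * q)%N by rewrite leq_mul2r leA orbT.
  have : (d * q <= d.-1 * q + q)%N by rewrite -mulSnr leq_mul2r leqSpred orbT.
  move: #|F| (d.-1 * q)%N (#|A| * q)%N (d * q)%N (\sum_(a | _) _)%N => *; lia.
left; have : (\sum_(a | a \notin A) aff_zeros p (a *: u + w)%R <= #|~: A| * (d - #|A| - 1))%N.
  rewrite -sum_nat_const big_mkcond [leqRHS]big_mkcond.
  by apply: leq_sum => a _; rewrite !inE; have := cA a; rewrite inE; case: ifP => // _; lia.
move: cAq A1 gtA dq; move: #|A| #|~: A| #|F| (\sum_(a | _) _)%N => n n' Q S <-.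
move=> n1 nd dQ leS.
have {leS} : (S <= n' * (d - n.+1))%N by rewrite subnS -subn1.
(* In these parameters [n (d - 1 - n)] is [(k + 1)(e + 1)], which is at least
   [k + e + 1 = d - 2]. *)
have [e Ed] : exists e, d = (n.+2 + e)%N by exists (d - n.+2)%N; lia.
have [k En] : exists k, n = k.+1 by exists n.-1; lia.
rewrite Ed En (_ : k.+3 + e - k.+2 = e.+1)%N; last by lia.
nia.
Qed.

End Pencils.

(** * Lines not contained in the curve have deficiency 0 or 1 *)

Section Lines.
Variables (F : finFieldType) (d : nat) (P : {mpoly F[3]}).
Hypothesis Phom : P \is d.-homog.
Local Notation f := (eval_row P).
Local Notation q := #|F|.
Local Notation aff_zeros := (aff_zeros P).

Lemma pencil_deficiency_sum u p w N : free3 u p w -> f p != 0 ->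
  #|cone_zeros P| = ((q - 1) * N)%N ->
  ((d - aff_zeros p u) + \sum_a (d - aff_zeros p (a *: u + w)%R) + N = d * q + d)%N.
Proof.
move=> upw fp; have q1 : (1 < q)%N by apply: card_finNzRing_gt1.
rewrite (pencil_sum Phom upw) (negPf fp) => /eqP; rewrite eqn_pmul2l; last by lia.
move=> /eqP <-; rewrite add0n.
have cu := aff_zeros_le Phom u fp.
have : (\sum_a (d - aff_zeros p (a *: u + w)%R) +
        \sum_a aff_zeros p (a *: u + w)%R = d * q)%N.
  rewrite -big_split /= (eq_bigr (fun=> d)) => [|a _]; last first.
    by rewrite subnK // (aff_zeros_le Phom).
  by rewrite sum_nat_const mulnC.
move: (d * q)%N (\sum_a _)%N (\sum_a _)%N => x y z; lia.
Qed.

Lemma line_zeros_ge u p w N : free3 u p w -> f p != 0 -> (3 <= d)%N -> (d <= q)%N ->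
  #|cone_zeros P| = ((q - 1) * N)%N -> (d * q - d + 3 < N)%N -> (N <= d * q)%N ->
  (d - 1 <= aff_zeros p w)%N.
Proof.
move=> upw fp d3 dq cN ltN leN.
have cle v : (aff_zeros p v <= d)%N by apply: (aff_zeros_le Phom).
(* The total deficiency of the pencil at [p] is at most [2 d - 4]. *)
have Dle : (d * q + d <= 2 * d - 4 + N)%N.
  have : (d <= d * q)%N by rewrite leq_pmulr //; lia.
  by move: (d * q)%N ltN => x; lia.
rewrite leqNgt; apply/negP => cw; pose s := (d - aff_zeros p w)%N.
have [le_s|gt_s] := leqP s (d - 2).
  (* With [2 <= s <= d - 2] one has [s (d - s) >= 2 (d - 2)], so the lines other than the one at
     infinity already use up the whole deficiency. Any line through [p] except the one through [w]
     may be put at infinity, hence has deficiency 0; then the truncated sum is only [s], less than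
     [s (d - s)]. *)
  have max_inf u' : free3 u' p w -> aff_zeros p u' = d.
    move=> u'pw; apply/eqP; rewrite eqn_leq cle leqNgt; apply/negP => cu'.
    have := pencil_deficiency_sum u'pw fp cN.
    have := pencil_deficiency_ge Phom u' w 0 fp dq; rewrite scale0r add0r -/s => le1.
    have /(leq_trans le1) : (\sum_a minn (d - aff_zeros p (a *: u' + w)%R) s <=
              \sum_a (d - aff_zeros p (a *: u' + w)%R))%N.
      by apply: leq_sum => a _; apply: geq_minl.
    have : (2 * (d - 2) <= s * (d - s))%N by move: le_s; rewrite /s in cw *; nia.
    move: (\sum_a _)%N (s * (d - s))%N (d * q)%N Dle => x y z; lia.
  have := pencil_deficiency_ge Phom u w 0 fp dq; rewrite scale0r add0r -/s.
  rewrite (bigD1 0) //= scale0r add0r -/s minnn big1 ?addn0 => [|a a0]; last first.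
    rewrite max_inf ?subnn ?min0n // => x y z E.
    case: (upw (x * a) y (x + z)); last first.
      move=> /eqP; rewrite mulf_eq0 (negPf a0) orbF => /eqP-> -> /eqP.
      by rewrite add0r => /eqP->.
    by rewrite -E scalerDr scalerA scalerDl -!addrA; congr (_ + _); rewrite addrCA.
  have s2 : (2 <= s)%N by rewrite /s; lia.
  have : (s * 2 <= s * (d - s))%N by rewrite leq_mul2l; apply/orP; right; lia.
  move: (s * (d - s))%N => x; lia.
have wpu : free3 w p u.
  move=> x y z E; case: (upw z y x) => [|-> -> ->] //.
  by rewrite -E -addrA addrC [y *: p + _]addrC.
(* Now [s >= d - 1] and the line through [w] is at infinity. A positive deficiency [s'] elsewhere
   would force at least [d - 1] more in total, exceeding [2 d - 4]. *)
have all0 a : aff_zeros p (a *: w + u) = d.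
  apply/eqP; rewrite eqn_leq cle leqNgt; apply/negP => ca.
  have := pencil_deficiency_sum wpu fp cN.
  have := pencil_deficiency_ge Phom w u a fp dq.
  set s' := (d - aff_zeros p (a *: w + u))%N => le1.
  have /(leq_trans le1) : (\sum_a minn (d - aff_zeros p (a *: w + u)%R) s' <=
            \sum_a (d - aff_zeros p (a *: w + u)%R))%N.
    by apply: leq_sum => b _; apply: geq_minl.
  have : (s' <= \sum_a (d - aff_zeros p (a *: w + u)%R))%N by rewrite (bigD1 a) //= leq_addr.
  have s'1 : (0 < s' <= d)%N by rewrite /s'; lia.
  have : (d - 1 <= s' * (d - s'))%N \/ s' = d by nia.
  move: (\sum_a _)%N (s' * (d - s'))%N (d * q)%N Dle gt_s; rewrite /s => x y z; lia.
have := pencil_deficiency_sum wpu fp cN.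
rewrite big1 ?addn0 => [|a _]; last by rewrite all0 subnn.
(* The line through [w] carries the whole deficiency, so [N <= d q] forces [s = d]: this line misses
   the curve. Hence no line through a point [Q] of the curve is contained in it, and the tangent
   bound at [Q] contradicts [N = d q]. *)
move=> Dw; have Nq : N = (d * q)%N by move: Dw leN (cle w); move: (d * q)%N => x; lia.
have cw0 : aff_zeros p w = 0%N by move: Dw (cle w); rewrite Nq; move: (d * q)%N => x; lia.
have fw y : f (w + y *: p) != 0.
  by apply/negP => fy; move/card0_eq: cw0 => /(_ y); rewrite inE fy.
have q1 : (1 < q)%N by apply: card_finNzRing_gt1.
have /card_gt0P[Q] : (0 < #|cone_zeros P|)%N.
  by rewrite cN Nq !muln_gt0 subn_gt0 q1 (ltnW q1) andbT /=; lia.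
rewrite inE => /andP[Q0 /eqP fQ].
have pw : free2 p w by move=> y z E; case: (upw 0 y z) => //; rewrite scale0r add0r.
have Qpw : free3 Q p w.
  apply: free3_extend => // y z; apply/eqP => QE; move/eqP: fQ; rewrite QE.
  have [z0|z0] := eqVneq z 0.
    move: Q0; rewrite QE z0 scale0r addr0 scaler_eq0 negb_or => /andP[y0 _].
    by rewrite (eval_rowZ Phom) mulf_eq0 expf_eq0 (negPf y0) (negPf fp) andbF.
  have -> : y *: p + z *: w = z *: (w + (z^-1 * y) *: p).
    by rewrite scalerDr scalerA mulrA mulfV // mul1r addrC.
  by rewrite (eval_rowZ Phom) mulf_eq0 expf_eq0 (negPf z0) (negPf (fw _)) andbF.
have pQw : free3 p Q w.
  by move=> x y z E; case: (Qpw y x z) => [|-> -> ->] //; rewrite -E [y *: _ + _]addrC.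
have ltq v : f v != 0 -> (aff_zeros Q v < q)%N.
  move=> fv; rewrite -cardsT proper_card //; apply/properP; split; first exact: subsetT.
  by exists 0; rewrite ?inE // scale0r addr0.
have := pencil_tangent_bound Phom pQw (ltnW d3) fQ cN (ltq _ fp).
rewrite Nq => bound.
suff : (d * q + q + 1 <= d * q + d)%N by move: dq; move: (d * q)%N #|F| => x y; lia.
by apply: bound => a; rewrite ltq // addrC fw.
Qed.

End Lines.

(** * Duality and the moments of line intersections *)

Lemma card_left_kernel (F : finFieldType) m n (M : 'M[F]_(m, n)) :
  #|[set v : 'rV[F]_m | v *m M == 0]| = (#|F| ^ (m - \rank M))%N.
Proof.
rewrite -mxrank_ker -card_rowg; apply: eq_card => v.
by rewrite !inE; apply/eqP/sub_kermxP.
Qed.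

(** A nonzero [h] in dimension 3 encodes the line of points perpendicular to it. Proportional [h]
    give the same line, so sums over [h] count every line [q - 1] times. *)
Definition perp (F : fieldType) n (v h : 'rV[F]_n) := v *m h^T == 0.

Lemma perpC (F : fieldType) n (v h : 'rV[F]_n) : perp v h = perp h v.
Proof. by rewrite /perp -trmx_eq0 trmx_mul trmxK. Qed.

Lemma perp_comb (F : fieldType) n (h v w : 'rV[F]_n) y z :
  perp v h -> perp w h -> perp (y *: v + z *: w) h.
Proof.
by rewrite /perp mulmxDl -!scalemxAl => /eqP-> /eqP->; rewrite !scaler0 addr0.
Qed.

Lemma card_perp (F : finFieldType) n (v : 'rV[F]_n) :
  v != 0 -> #|[set h | perp h v]| = (#|F| ^ n.-1)%N.
Proof. by move=> v0; rewrite card_left_kernel mxrank_tr rank_rV v0 subn1. Qed.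

Lemma card_perp2 (F : finFieldType) n (v w : 'rV[F]_n) :
  free2 v w -> #|[set h | perp h v && perp h w]| = (#|F| ^ n.-2)%N.
Proof.
move=> vw; have rk : \rank (col_mx v w)^T = 2%N.
  rewrite mxrank_tr; apply/eqP; apply: inj_row_free => x.
  rewrite -[x]hsubmxK mul_row_col [lsubmx x]mx11_scalar [rsubmx x]mx11_scalar !mul_scalar_mx.
  by move=> /vw[-> ->]; rewrite !raddf0 row_mx0.
rewrite -subn2 -rk -card_left_kernel; apply: eq_card => h.
by rewrite !inE /perp tr_col_mx mul_mx_row row_mx_eq0.
Qed.

Lemma sum_nat_bool (T : finType) (A B : pred T) :
  (\sum_(x | A x) B x = #|[set x | A x && B x]|)%N.
Proof.
rewrite -sum1_card big_mkcond [RHS]big_mkcond /=; apply: eq_bigr => x _.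
by rewrite inE; case: (A x); case: (B x).
Qed.

Section Moments.
Variables (F : finFieldType) (d : nat) (P : {mpoly F[3]}).
Hypothesis Phom : P \is d.-homog.
Local Notation f := (eval_row P).
Local Notation q := #|F|.
Local Notation cone := (cone_zeros P).

(** For nonzero [h] this is [q - 1] times the number of points of the curve on the line of [h]. *)
Definition line_cone (h : 'rV[F]_3) := (\sum_(v in cone) perp v h)%N.

Lemma card_cone_multiples (v : 'rV[F]_3) : v != 0 ->
  #|[set k *: v | k in [set k : F | k != 0]]| = (q - 1)%N.
Proof.
move=> v0; rewrite card_imset ?cardsE.
  by rewrite subn1 -(cardC1 (0 : F)); apply: eq_card.
by move=> k k' /eqP; rewrite -subr_eq0 -scalerBl scaler_eq0 (negPf v0) orbF subr_eq0 => /eqP.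
Qed.

Lemma free2_notin_multiples (v w : 'rV[F]_3) : v != 0 -> w != 0 ->
  w \notin [set k *: v | k in [set k : F | k != 0]] -> free2 v w.
Proof.
move=> v0 w0 wv y z E; have z0 : z = 0.
  apply/eqP; apply: contraNT wv => z0.
  have wE : w = - (z^-1 * y) *: v.
    have : z^-1 *: (y *: v + z *: w) = 0 by rewrite E scaler0.
    by rewrite scalerDr !scalerA mulVf // scale1r addrC scaleNr => /eqP; rewrite addr_eq0 => /eqP.
  apply/imsetP; exists (- (z^-1 * y)) => //; rewrite inE.
  by apply: contraNneq w0 => k0; rewrite wE k0 scale0r.
split=> //; move/eqP: E; rewrite z0 scale0r addr0 scaler_eq0 (negPf v0) orbF.
by move/eqP.
Qed.

Lemma sum_line_cone : (\sum_(h | h != 0%R) line_cone h = #|cone| * (q ^ 2 - 1))%N.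
Proof.
rewrite exchange_big /= -sum_nat_const; apply: eq_bigr => v; rewrite inE => /andP[v0 _].
rewrite -(card_perp v0) sum_nat_bool (cardsD1 0 [set h | perp h v]) inE /perp mul0mx eqxx.
by rewrite add1n subn1 /=; apply: eq_card => h; rewrite !inE -/(perp v h) perpC.
Qed.

(** Pairs of zeros are counted by their common lines: two proportional vectors have [q^2 - 1] common
    nonzero [h], two independent ones have [q - 1]. *)
Lemma sum_line_cone_sqr : (\sum_(h | h != 0%R) line_cone h ^ 2 =
  #|cone| * ((q - 1) * (q ^ 2 - 1) + (#|cone| - (q - 1)) * (q - 1)))%N.
Proof.
rewrite (eq_bigr (fun h => \sum_(v in cone) \sum_(w in cone) (perp v h && perp w h))%N); last first.
  move=> h _; rewrite -mulnn /line_cone big_distrlr /=.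
  by do 2!apply: eq_bigr => ? _; rewrite mulnb.
rewrite exchange_big /= -sum_nat_const; apply: eq_bigr => v vC.
have := vC; rewrite inE => /andP[v0 fv]; rewrite exchange_big /=.
pose V := [set k *: v | k in [set k : F | k != 0]].
have sVC : V \subset cone.
  by apply/subsetP => w /imsetP[k]; rewrite inE => k0 ->; rewrite (cone_zerosZ Phom).
have cV : #|V| = (q - 1)%N by apply: card_cone_multiples.
rewrite (bigID (mem V)) /=; congr addn.
  rewrite (eq_bigl (mem V)) => [|w /=]; last first.
    by apply: andb_idl => /(subsetP sVC).
  rewrite -cV -sum_nat_const; apply: eq_bigr => w /imsetP[k]; rewrite inE => k0 ->.
  rewrite -(card_perp v0) sum_nat_bool (cardsD1 0 [set h | perp h v]) inE /perp mul0mx eqxx.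
  rewrite add1n subn1 /=; apply: eq_card => h.
  by rewrite !inE -scalemxAl scaler_eq0 (negPf k0) /= andbb -/(perp v h) perpC.
rewrite (eq_bigl (mem (cone :\: V))) => [|w /=]; last by rewrite !inE andbC.
have <- : #|cone :\: V| = (#|cone| - (q - 1))%N.
  by rewrite cardsD (setIidPr sVC) cV.
rewrite -sum_nat_const; apply: eq_bigr => w; rewrite !inE => /and3P[wV w0 _].
have vw : free2 v w by apply: free2_notin_multiples.
have := card_perp2 vw; rewrite expn1 sum_nat_bool => <-.
rewrite (cardsD1 0 [set h | perp h v && perp h w]) inE /perp !mul0mx eqxx.
rewrite add1n subn1 /=; apply: eq_card => h.
by rewrite !inE -/(perp v h) -/(perp w h) perpC [perp w h]perpC.
Qed.

Lemma line_cone_full h : h != 0 ->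
  (forall v, perp v h -> f v = 0) -> line_cone h = ((q - 1) * q.+1)%N.
Proof.
move=> h0 fh; rewrite /line_cone sum_nat_bool.
have -> : ((q - 1) * q.+1 = q ^ 2 - 1)%N.
  by rewrite -[q.+1]addn1 -subn_sqr exp1n.
rewrite -(card_perp h0) (cardsD1 0 [set v | perp v h]) inE /perp mul0mx eqxx.
rewrite add1n subn1 /=; apply: eq_card => v; rewrite !inE -andbA; congr andb.
by apply/andb_idl => /fh ->.
Qed.

(** A line not contained in the curve has a point [p] with [f p] nonzero; [line_zeros_ge] applies
    with [w] a second point of the line and [u] a point off it. *)
Lemma line_cone_cases N h : (3 <= d)%N -> (d <= q)%N -> #|cone| = ((q - 1) * N)%N ->
  (d * q - d + 3 < N)%N -> (N <= d * q)%N -> h != 0 ->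
  (forall v, perp v h -> f v = 0) \/
  (exists2 z, line_cone h = ((q - 1) * z)%N & (d - 1 <= z <= d)%N).
Proof.
move=> d3 dq cN ltN leN h0; have q1 : (1 < q)%N by apply: card_finNzRing_gt1.
pose W := [set v : 'rV[F]_3 | perp v h].
have cW : #|W| = (q ^ 2)%N by apply: card_perp.
have [/forallP Wf|] := boolP [forall v, perp v h ==> (f v == 0)].
  by left=> v vh; apply/eqP; have := Wf v; rewrite vh.
rewrite negb_forall => /existsP[p]; rewrite negb_imply => /andP[ph fp]; right.
have p0 : p != 0.
  apply: contraNneq fp => ->; rewrite -(scale0r 0) (eval_rowZ Phom) expr0n.
  by rewrite (_ : (d == 0)%N = false) ?mul0r //; lia.
have [|w wW pw] := @free2_extend _ _ p W p0.
  by rewrite cW -{1}(expn1 q) ltn_exp2l.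
have wh : perp w h by move: wW; rewrite inE.
have WE : [set x.1 *: p + x.2 *: w | x : F * F] = W.
  apply/eqP; rewrite eqEcard (free2_span_card pw) cW leqnn andbT.
  by apply/subsetP => v /imsetP[x _ ->]; rewrite inE perp_comb.
have /subsetPn[u _ uW] : ~~ ([set: 'rV[F]_3] \subset W).
  apply/negP => /subset_leq_card; rewrite cW cardsT card_mx leq_exp2l //.
have upw : free3 u p w.
  apply: free3_extend => // y z; apply: contraNneq uW => ->.
  by rewrite inE perp_comb.
exists (aff_zeros P p w); last first.
  by rewrite (line_zeros_ge Phom upw fp d3 dq cN ltN leN) (aff_zeros_le Phom).
have := plane_sum Phom pw; rewrite (negPf fp) add0n => <-.
have -> : line_cone h = (\sum_(v in W) (v \in cone))%N.
  by rewrite /line_cone !sum_nat_bool; apply: eq_card => v; rewrite !inE andbC.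
rewrite -WE big_imset /= => [|[y z] [y' z'] _ _ /eqP]; last first.
  rewrite -subr_eq0 opprD addrACA -!scalerBl => /eqP/pw[] /= /eqP + /eqP.
  by rewrite !subr_eq0 => /eqP-> /eqP->.
rewrite [RHS]exchange_big [RHS]pair_bigA /=; apply: eq_big => [x|[y z] _] /=.
  by rewrite inE.
by rewrite addrC.
Qed.

(** Two distinct contained lines meet in a point [p], and [pencil_two_lines] at [p] leaves only
    values of [N] outside the assumed range. *)
Lemma contained_lines_dep N h h' : (d <= q)%N -> #|cone| = ((q - 1) * N)%N ->
  (d * q - d + 3 < N)%N -> (N <= d * q)%N -> free2 h h' ->
  (forall v, perp v h -> f v = 0) -> ~ (forall v, perp v h' -> f v = 0).
Proof.
move=> dq cN ltN leN hh' fh fh'; have q1 : (1 < q)%N by apply: card_finNzRing_gt1.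
have cV : #|[set v | perp v h && perp v h']| = q by rewrite (card_perp2 hh') expn1.
have /subsetPn[p] : ~~ ([set v | perp v h && perp v h'] \subset [set 0]).
  by apply/negP => /subset_leq_card; rewrite cV cards1 leqNgt q1.
rewrite !inE => /andP[ph ph'] p0.
have h0 : h != 0.
  apply/eqP => h0; case: (hh' 1 0); rewrite ?h0 ?scaler0 ?scale0r ?addr0 // => /eqP.
  by rewrite oner_eq0.
have h'0 : h' != 0.
  apply/eqP => h'0; case: (hh' 0 1); rewrite ?h'0 ?scaler0 ?scale0r ?addr0 // => _ /eqP.
  by rewrite oner_eq0.
have [|w + pw] := @free2_extend _ _ p [set v | perp v h] p0.
  by rewrite card_perp // -{1}(expn1 q) ltn_exp2l.
have [|u + pu] := @free2_extend _ _ p [set v | perp v h'] p0.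
  by rewrite card_perp // -{1}(expn1 q) ltn_exp2l.
rewrite !inE => uh' wh.
have sub v : perp v h -> perp v h' -> exists k, v = k *: p.
  move=> vh vh'; suff : v \in [set k *: p | k : F] by case/imsetP=> k _ ->; exists k.
  have /eqP -> : [set k *: p | k : F] == [set v | perp v h && perp v h'].
    rewrite eqEcard; apply/andP; split.
      apply/subsetP => v' /imsetP[k _ ->]; rewrite inE.
      by rewrite -[k *: p]addr0 -(scale0r p) !perp_comb.
    rewrite cV card_imset // => k k' /eqP.
    by rewrite -subr_eq0 -scalerBl scaler_eq0 (negPf p0) orbF subr_eq0 => /eqP.
  by rewrite inE vh.
have upw : free3 u p w.
  apply: free3_extend => // y z; apply/eqP => uE.
  have [|k uk] := sub u _ uh'; first by rewrite uE perp_comb.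
  have [|_ /eqP] := pu (- k) 1; last by rewrite oner_eq0.
  by rewrite scale1r uk scaleNr addNr.
have zq v g : perp v g -> perp p g -> (forall v, perp v g -> f v = 0) -> aff_zeros P p v = q.
  move=> vg pg fg; rewrite /aff_zeros -cardsT; apply: eq_card => y; rewrite !inE.
  by rewrite fg ?eqxx // -[v]scale1r perp_comb.
have := pencil_two_lines Phom upw dq (fh p ph) cN (zq u h' uh' ph' fh') (zq w h wh ph fh).
by move: ltN leN; move: (d * q)%N => x; lia.
Qed.

Lemma card_contained_lines N : (d <= q)%N -> #|cone| = ((q - 1) * N)%N ->
  (d * q - d + 3 < N)%N -> (N <= d * q)%N ->
  (#|[set h | (h != 0%R) && [forall v, perp v h ==> (f v == 0%R)]]| <= q - 1)%N.
Proof.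
move=> dq cN ltN leN; set K := [set h | _].
have KP h : h \in K -> h != 0 /\ forall v, perp v h -> f v = 0.
  rewrite inE => /andP[h0 /forallP hf]; split=> // v vh.
  by apply/eqP; have := hf v; rewrite vh.
have [->|[h hK]] := set_0Vmem K; first by rewrite cards0.
have [h0 hf] := KP h hK; rewrite -(card_cone_multiples h0).
apply/subset_leq_card/subsetP => h' h'K; have [h'0 h'f] := KP h' h'K.
apply/negPn/negP => /(free2_notin_multiples h0 h'0) hh'.
exact: (contained_lines_dep dq cN ltN leN hh' hf h'f).
Qed.

End Moments.

(* Up to the substitution d = i + 3, q = i + j + 3, this says that the quadratic
   N^2 - ((2d-1)(q+1) - q) N + d(d-1)(q^2+q+1) - (q+1-d)(q+2-d) has negative discriminant. *)
Lemma moment_quadratic_pos d q N : (3 <= d)%N -> (d <= q)%N ->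
  ((2 * d - 1) * (N * q.+1) + (q.+1 - d) * (q.+2 - d) <
   N * (q.+1 + (N - 1)) + (q ^ 2 + q + 1) * (d * (d - 1)))%N.
Proof.
move=> d3 dq.
have [i Ei] : exists i, d = i.+3 by exists (d - 3)%N; lia.
have [j Ej] : exists j, q = (i + j).+3 by exists (q - i - 3)%N; lia.
have -> : (2 * d - 1 = 2 * i + 5)%N by lia.
have -> : (q.+1 - d = j.+1)%N by lia.
have -> : (q.+2 - d = j.+2)%N by lia.
have -> : (d - 1 = i.+2)%N by lia.
pose M := ((2 * i + 5) * q.+1 - q)%N.
have EM : (M + q = (2 * i + 5) * q.+1)%N by rewrite subnK //; nia.
have sq : (4 * (M * N) <= M * M + 4 * (N * N))%N.
  have -> : (4 * (M * N) = 2 * (M * (2 * N)))%N by lia.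
  have -> : (4 * (N * N) = (2 * N) ^ 2)%N by rewrite expnMn -mulnn.
  by rewrite mulnn nat_Cauchy.
have -> : ((2 * i + 5) * (N * q.+1) = M * N + q * N)%N by rewrite -mulnDl EM; lia.
have -> : (N * (q.+1 + (N - 1)) = N * N + q * N)%N by case: (N) => [|n]; rewrite ?muln0 // subn1 /=; lia.
have {}EM : M = (2 * (i * i) + 2 * (i * j) + 12 * i + 4 * j + 17)%N by move: EM; rewrite Ej; nia.
(* [M] is minus the linear coefficient of the quadratic, and the last parenthesis is minus its
   discriminant. *)
have : (4 * ((q * q + q + 1) * (d * i.+2)) = M * M + 4 * (j.+1 * j.+2) +
   (15 + 20 * (i + j) + 4 * ((i + j) * (i + j)) + 16 * (i * j) + 4 * (i * j * (i + j))))%N.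
  by rewrite EM Ei Ej; nia.
rewrite -mulnn; move: (_ * (d * i.+2))%N (M * M)%N (M * N)%N (N * N)%N (q * N)%N sq => *; lia.
Qed.

(** * Passage to projective points and the final count *)

(** The projective classes partition the cone into sets of [q - 1] vectors; the bijection [r]
    identifies row vectors with finite functions. *)
Lemma card_rat_points (F : finFieldType) (P : {mpoly F[3]}) d : P \is d.-homog ->
  #|cone_zeros P| = ((#|F| - 1) * #|rat_points P|)%N.
Proof.
move=> Phom; set S := [set v : vec3 F | (v != 0) && (P.@[v] == 0)].
pose r (x : 'rV[F]_3) : vec3 F := [ffun i => x 0 i].
have rE x : P.@[r x] = eval_row P x by apply: meval_eq => i; rewrite ffunE.
have r_inj : injective r.
  by move=> x y /ffunP E; apply/rowP => i; have := E i; rewrite !ffunE.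
have r0 x : (r x == 0) = (x == 0).
  apply/eqP/eqP => [E|->]; last by apply/ffunP => i; rewrite !ffunE mxE.
  by apply/rowP => i; move/ffunP: E => /(_ i); rewrite !ffunE mxE.
have rZ k x : r (k *: x) = [ffun i => k * r x i].
  by apply/ffunP => i; rewrite !ffunE mxE.
have r_surj v : exists x, v = r x.
  by exists (\row_i v i); apply/ffunP => i; rewrite ffunE mxE.
have SE : S = r @: cone_zeros P.
  apply/setP => v; have [x ->] := r_surj v.
  by rewrite (mem_imset _ _ r_inj) !inE r0 rE.
have classE x : proj_class (r x) = r @: [set k *: x | k in [set k : F | k != 0]].
  by rewrite -imset_comp; apply: eq_imset => k /=; rewrite rZ.
rewrite -(card_imset _ r_inj) -SE /rat_points -/S -sum1_card.
rewrite (partition_big_imset (@proj_class F)) /= mulnC -sum_nat_const.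
apply: eq_bigr => c /imsetP[v vS ->]; rewrite sum1_card.
have [x Ex] := r_surj v; move: vS; rewrite {}Ex SE (mem_imset _ _ r_inj) => xC.
have x0 : x != 0 by move: xC; rewrite inE => /andP[].
rewrite -(card_cone_multiples x0) -[RHS](card_imset _ r_inj) -classE.
apply: eq_card => v'; have [y ->] := r_surj v'; rewrite [LHS]unfold_in /=.
have -> : (r y \in proj_class (r x)) = (y \in [set k *: x | k in [set k : F | k != 0]]).
  by rewrite classE (mem_imset _ _ r_inj).
apply/andP/imsetP => [[yS /eqP E]|[k k0 ->]].
  have : r y \in proj_class (r y).
    by rewrite classE (mem_imset _ _ r_inj); apply/imsetP; exists 1; rewrite ?scale1r ?inE ?oner_eq0.
  by rewrite E classE (mem_imset _ _ r_inj) => /imsetP[k k0 ->]; exists k.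
rewrite inE in k0.
rewrite (mem_imset _ _ r_inj) (cone_zerosZ Phom) //; split=> //.
rewrite !classE; apply/eqP; suff -> : [set l *: (k *: x) | l in [set l : F | l != 0]] =
  [set l *: x | l in [set l : F | l != 0]] by [].
apply/setP => z.
apply/imsetP/imsetP => [] [l]; rewrite inE => l0 ->.
  by exists (l * k); rewrite ?scalerA // inE mulf_neq0.
by exists (l / k); rewrite ?scalerA ?divfK // inE mulf_neq0 ?invr_eq0.
Qed.

Theorem theorem4p1 (F : finFieldType) (d : nat) (P : {mpoly F[3]}) :
  (3 <= d)%N -> (d <= #|F|)%N ->
  P != 0 -> P \is d.-homog ->
  (#|rat_points P| < d * #|F| + 1)%N ->
  (#|rat_points P| <= d * #|F| - d + 3)%N.
Proof.
move=> d3 dq _ Phom; have := card_rat_points Phom.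
move: #|rat_points P| => N cN; rewrite addn1 ltnS => leN; rewrite leqNgt; apply/negP => ltN.
have q1 : (1 < #|F|)%N by apply: card_finNzRing_gt1.
set q := #|F| in dq cN leN ltN q1 *.
have d0 : (0 < d)%N by lia.
have r0 : (0 < q - 1)%N by rewrite subn_gt0.
pose full (h : 'rV[F]_3) := [forall v, perp v h ==> (eval_row P v == 0)].
pose z h := (line_cone P h %/ (q - 1))%N.
(* The inequality bounds [(z - d)(z - (d - 1))], which is 0 for a line with [d - 1] or [d] points
   and [(q + 1 - d)(q + 2 - d)] for a contained line, where [z = q + 1]. *)
have zP h : h != 0 -> line_cone P h = ((q - 1) * z h)%N /\
    (z h ^ 2 + d * (d - 1) <= (2 * d - 1) * z h + full h * ((q.+1 - d) * (q.+2 - d)))%N.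
  move=> h0; have [fh|nfh] := boolP (full h).
    have E : line_cone P h = ((q - 1) * q.+1)%N.
      apply: (line_cone_full h0) => v vh.
      by apply/eqP; move/forallP: fh => /(_ v); rewrite vh.
    rewrite /z E mulKn //; split=> //; rewrite mul1n -mulnn.
    have [t Et] : exists t, q = (d + t)%N by exists (q - d)%N; rewrite subnKC.
    rewrite Et (_ : (d + t).+1 - d = t.+1)%N; last by lia.
    rewrite (_ : (d + t).+2 - d = t.+2)%N; last by lia.
    by case: (d) d0 => // e _; rewrite subn1 /=; nia.
  have [fh|[y E yd]] := line_cone_cases Phom d3 dq cN ltN leN h0.
    by case/negP: nfh; apply/forallP => v; apply/implyP => /fh ->.
  rewrite /z E mulKn //; split=> //; rewrite mul0n addn0 -mulnn.
  have [->|->] : y = d \/ y = (d - 1)%N by lia.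
    by case: (d) d0 => // e _; rewrite subn1 /=; nia.
  by case: (d) d0 => // e _; rewrite subn1 /=; nia.
have S1 : (\sum_(h : 'rV[F]_3 | h != 0%R) z h = N * (q ^ 2 - 1))%N.
  apply/eqP; rewrite -(eqn_pmul2l r0) big_distrr /=.
  rewrite -(eq_bigr _ (fun h h0 => (zP h h0).1)) sum_line_cone cN; apply/eqP; lia.
have S2 : (\sum_(h : 'rV[F]_3 | h != 0%R) z h ^ 2 =
           N * ((q ^ 2 - 1) + (N - 1) * (q - 1)))%N.
  apply/eqP; rewrite -(eqn_pmul2l (_ : 0 < (q - 1) ^ 2)%N) ?expn_gt0 ?r0 // big_distrr /=.
  rewrite (eq_bigr (fun h => line_cone P h ^ 2)%N) => [|h /zP[-> _]]; last by rewrite expnMn.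
  rewrite (sum_line_cone_sqr Phom) cN -/q -mulnn.
  have -> : ((q - 1) * N - (q - 1) = (q - 1) * (N - 1))%N by rewrite mulnBr muln1.
  by apply/eqP; move: (q ^ 2 - 1)%N (q - 1)%N (N - 1)%N => a b c; lia.
have cH : #|[pred h : 'rV[F]_3 | h != 0]| = (q ^ 3 - 1)%N.
  by rewrite (eq_card (B := predC1 0)) // cardC1 card_mx subn1 mul1n.
(* Summed over all [h] and divided by [q - 1], this is the reverse of [moment_quadratic_pos], since
   at most [q - 1] of the [h] give contained lines. *)
have leS : (\sum_(h : 'rV[F]_3 | h != 0%R) (z h ^ 2 + d * (d - 1)) <=
    \sum_(h : 'rV[F]_3 | h != 0%R)
      ((2 * d - 1) * z h + full h * ((q.+1 - d) * (q.+2 - d))))%N.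
  by apply: leq_sum => h h0; case: (zP h h0).
rewrite !big_split /= S2 sum_nat_const cH -big_distrr /= S1 -big_distrl /= in leS.
have leK : (\sum_(h : 'rV[F]_3 | h != 0%R) full h <= q - 1)%N.
  by rewrite sum_nat_bool; apply: (card_contained_lines Phom dq cN ltN leN).
have {leK}leS := leq_trans leS (leq_add (leqnn _) (leq_mul leK (leqnn _))).
have := moment_quadratic_pos N d3 dq; rewrite ltnNge => /negP; apply.
rewrite -(leq_pmul2l r0).
have E2 : (q ^ 2 - 1 = (q - 1) * q.+1)%N by rewrite -[q.+1]addn1 -subn_sqr exp1n.
have E3 : (q ^ 3 - 1 = (q - 1) * (q ^ 2 + q + 1))%N.
  by case: (q) q1 => // r _; rewrite !expnS expn0 !muln1 !subn1 /=; lia.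
rewrite E2 E3 in leS; move: leS; move: (q - 1)%N (q ^ 2 + q + 1)%N (N - 1)%N.
move: (d * (d - 1))%N (2 * d - 1)%N ((q.+1 - d) * (q.+2 - d))%N q.+1 => a b c e x y m; lia.
Qed.
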